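(* Let $T:V\to\mathfrak{L}$ be a relative Rota-Baxter operator on a Leibniz triple system $(\mathfrak{L},\{\cdot,\cdot,\cdot\})$ with respect to a representation $(r,m,l)$ of $\mathfrak{L}$ on $V$, and let $T_t=\sum_{i=0}^{n}\mathfrak{T}_it^i$ be an order $n$ deformation of $T$. Then $T_t$ is extendable if and only if the cohomology class $[\mathrm{Ob}_T]\in H^3_T(V,\mathfrak{L})$ is trivial, where $\mathrm{Ob}_T\in C^3_T(V,\mathfrak{L})$ is defined by $$\mathrm{Ob}_T(u,v,w)=\sum_{\substack{i+j+k=n+1\\0\le i,j,k\le n}}\Big(\{\mathfrak{T}_iu,\mathfrak{T}_jv,\mathfrak{T}_kw\}-\mathfrak{T}_i\big(l(\mathfrak{T}_ju,\mathfrak{T}_kv)w+m(\mathfrak{T}_ku,\mathfrak{T}_jw)v+r(\mathfrak{T}_jv,\mathfrak{T}_kw)u\big)\Big)$$ for all $u,v,w\in V$.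
   Context: All vector spaces are over a fixed arbitrary field $\mathbb{F}$. A Leibniz triple system is a vector space $\mathfrak{L}$ with a trilinear operation $\{\cdot,\cdot,\cdot\}:\mathfrak{L}\times\mathfrak{L}\times\mathfrak{L}\to\mathfrak{L}$ such that for all $a,b,c,d,e\in\mathfrak{L}$: $\{a,b,\{c,d,e\}\}=\{\{a,b,c\},d,e\}-\{\{a,b,d\},c,e\}-\{\{a,b,e\},c,d\}+\{\{a,b,e\},d,c\}$ and $\{a,\{b,c,d\},e\}=\{\{a,b,c\},d,e\}-\{\{a,c,b\},d,e\}-\{\{a,d,b\},c,e\}+\{\{a,d,c\},b,e\}$. A representation of $\mathfrak{L}$ on a vector space $V$ is a triple $(r,m,l)$ of bilinear maps $l,m,r:\mathfrak{L}\times\mathfrak{L}\to\mathrm{End}(V)$ such that for all $a,b,c,d\in\mathfrak{L}$: $l(a,\{b,c,d\})=l(\{a,b,c\},d)-l(\{a,c,b\},d)-l(\{a,d,b\},c)+l(\{a,d,c\},b)$; $m(a,d)l(b,c)=m(\{a,b,c\},d)-m(\{a,c,b\},d)-r(c,d)m(a,b)+r(b,d)m(a,c)$; $m(a,d)m(b,c)=r(c,d)l(a,b)-r(c,d)m(a,b)-m(\{a,c,b\},d)+r(b,d)l(a,c)$; $m(a,d)r(b,c)=r(c,d)m(a,b)-r(c,d)l(a,b)-r(b,d)l(a,c)+m(\{a,c,b\},d)$; $r(\{a,b,c\},d)=r(c,d)r(a,b)-r(c,d)r(b,a)-r(b,d)r(c,a)+r(a,d)r(c,b)$; $l(a,b)l(c,d)=l(\{a,b,c\},d)-l(\{a,b,d\},c)-r(c,d)l(a,b)+r(d,c)l(a,b)$;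 $l(a,b)m(c,d)=m(\{a,b,c\},d)-r(c,d)l(a,b)-l(\{a,b,d\},c)+m(\{a,b,d\},c)$; $l(a,b)r(c,d)=r(c,d)l(a,b)-m(\{a,b,c\},d)-m(\{a,b,d\},c)+l(\{a,b,d\},c)$; $m(a,\{b,c,d\})=r(c,d)m(a,b)-r(b,d)m(a,c)-r(b,c)m(a,d)+r(c,b)m(a,d)$; $r(a,\{b,c,d\})=r(c,d)r(a,b)-r(b,d)r(a,c)-r(b,c)r(a,d)+r(c,b)r(a,d)$. A relative Rota-Baxter operator on $(\mathfrak{L},\{\cdot,\cdot,\cdot\})$ with respect to $(r,m,l)$ is a linear map $T:V\to\mathfrak{L}$ with $\{Tu,Tv,Tw\}=T\big(l(Tu,Tv)w+m(Tu,Tw)v+r(Tv,Tw)u\big)$ for all $u,v,w\in V$. Cohomology of $T$: $V$ is a Leibniz triple system with $\{u,v,w\}_T=l(Tu,Tv)w+m(Tu,Tw)v+r(Tv,Tw)u$, and it has a representation $(r_T,m_T,l_T)$ on $\mathfrak{L}$ given by $l_T(u,v)x=\{Tu,Tv,x\}-T(r(Tv,x)u+m(Tu,x)v)$, $m_T(u,v)x=\{Tu,x,Tv\}-T(l(Tu,x)v+r(x,Tv)u)$, $r_T(u,v)x=\{x,Tu,Tv\}-T(l(x,Tu)v+m(x,Tv)u)$. $C^{k}_T(V,\mathfrak{L})$ ($k=1,3,5$) is the space of $k$-linear maps $V^{k}\to\mathfrak{L}$. For $f\in C^1_T$, $\partial^1f(v_1,v_2,v_3)=r_T(v_2,v_3)f(v_1)+m_T(v_1,v_3)f(v_2)+l_T(v_1,v_2)f(v_3)-f(\{v_1,v_2,v_3\}_T)$.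 For $g\in C^3_T$, $\partial^3_1g,\partial^3_2g\in C^5_T$ are $\partial^3_1g(v_1,\dots,v_5)=g(v_1,v_2,\{v_3,v_4,v_5\}_T)-g(\{v_1,v_2,v_3\}_T,v_4,v_5)+g(\{v_1,v_2,v_4\}_T,v_3,v_5)+g(\{v_1,v_2,v_5\}_T,v_3,v_4)-g(\{v_1,v_2,v_5\}_T,v_4,v_3)+l_T(v_1,v_2)g(v_3,v_4,v_5)-r_T(v_4,v_5)g(v_1,v_2,v_3)+r_T(v_3,v_5)g(v_1,v_2,v_4)+r_T(v_3,v_4)g(v_1,v_2,v_5)-r_T(v_4,v_3)g(v_1,v_2,v_5)$, $\partial^3_2g(v_1,\dots,v_5)=g(v_1,\{v_2,v_3,v_4\}_T,v_5)-g(\{v_1,v_2,v_3\}_T,v_4,v_5)+g(\{v_1,v_3,v_2\}_T,v_4,v_5)+g(\{v_1,v_4,v_2\}_T,v_3,v_5)-g(\{v_1,v_4,v_3\}_T,v_2,v_5)+m_T(v_1,v_5)g(v_2,v_3,v_4)-r_T(v_4,v_5)g(v_1,v_2,v_3)+r_T(v_4,v_5)g(v_1,v_3,v_2)+r_T(v_3,v_5)g(v_1,v_4,v_2)-r_T(v_2,v_5)g(v_1,v_4,v_3)$. $Z^3_T=\{g\in C^3_T:\partial^3_1g=\partial^3_2g=0\}$, $B^3_T=\{\partial^1f: f\in C^1_T\}$, $H^3_T(V,\mathfrak{L})=Z^3_T/B^3_T$. The class $[g]$ is trivial if $g\in B^3_T$. The ternary product and $l,m,r$ are extended $t$-multilinearly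 to $\mathfrak{L}[[t]]$ and $V[[t]]$ (coefficientwise convolution), and to the quotients modulo $t^{n+1}$. An order $n$ deformation of $T$ is $T_t=\sum_{i=0}^n\mathfrak{T}_it^i$ with $\mathfrak{T}_0=T$, $\mathfrak{T}_i\in\mathrm{Hom}_{\mathbb{F}}(V,\mathfrak{L})$ for $i=1,\dots,n$, regarded as an $\mathbb{F}[[t]]/(t^{n+1})$-module map $V[[t]]/(t^{n+1})\to\mathfrak{L}[[t]]/(t^{n+1})$, such that $\{T_t(u),T_t(v),T_t(w)\}=T_t\big(l(T_t(u),T_t(v))w+m(T_t(u),T_t(w))v+r(T_t(v),T_t(w))u\big)$ in $\mathfrak{L}[[t]]/(t^{n+1})$ for all $u,v,w\in V$. It is extendable if there is $\mathfrak{T}_{n+1}\in\mathrm{Hom}_{\mathbb{F}}(V,\mathfrak{L})$ such that $T_t+\mathfrak{T}_{n+1}t^{n+1}$ is an order $n+1$ deformation of $T$. *)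

(* Defs.v *)
From HB Require Import structures.
From mathcomp Require Import all_boot all_order all_algebra.

Set Implicit Arguments.
Unset Strict Implicit.
Unset Printing Implicit Defensive.

Import GRing.Theory.
Local Open Scope ring_scope.

Definition trilinear (F : fieldType) (A B C D : lmodType F)
    (p : A -> B -> C -> D) : Prop :=
  [/\ forall b c, linear (fun a => p a b c),
      forall a c, linear (fun b => p a b c)
    & forall a b, linear (fun c => p a b c)].

Record leibniz_triple_system (F : fieldType) (L : lmodType F)
    (br : L -> L -> L -> L) : Prop := LeibnizTripleSystem {
  lts_trilinear : trilinear br;
  lts_right : forall a b c d e,
    br a b (br c d e) =
      br (br a b c) d e - br (br a b d) c e - br (br a b e) c d
      + br (br a b e) d c;
  lts_middle : forall a b c d e,
    br a (br b c d) e =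
      br (br a b c) d e - br (br a c b) d e - br (br a d b) c e
      + br (br a d c) b e }.

(* The values of r, m, l are endomorphisms of V, so linearity in the V-argument
   is part of the type. *)
Definition bilinear_End (F : fieldType) (L V : lmodType F)
    (p : L -> L -> {linear V -> V}) : Prop :=
  (forall b x, linear (fun a => p a b x)) /\
  (forall a x, linear (fun b => p a b x)).

Record lts_representation (F : fieldType) (L V : lmodType F)
    (br : L -> L -> L -> L) (r m l : L -> L -> {linear V -> V}) : Prop :=
  LtsRepresentation {
  rep_r_bilinear : bilinear_End r;
  rep_m_bilinear : bilinear_End m;
  rep_l_bilinear : bilinear_End l;
  rep_l_middle : forall a b c d x,
    l a (br b c d) x =
      l (br a b c) d x - l (br a c b) d x - l (br a d b) c x
      + l (br a d c) b x;
  rep_ml : forall a b c d x,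
    m a d (l b c x) =
      m (br a b c) d x - m (br a c b) d x - r c d (m a b x) + r b d (m a c x);
  rep_mm : forall a b c d x,
    m a d (m b c x) =
      r c d (l a b x) - r c d (m a b x) - m (br a c b) d x + r b d (l a c x);
  rep_mr : forall a b c d x,
    m a d (r b c x) =
      r c d (m a b x) - r c d (l a b x) - r b d (l a c x) + m (br a c b) d x;
  rep_r_middle : forall a b c d x,
    r (br a b c) d x =
      r c d (r a b x) - r c d (r b a x) - r b d (r c a x) + r a d (r c b x);
  rep_ll : forall a b c d x,
    l a b (l c d x) =
      l (br a b c) d x - l (br a b d) c x - r c d (l a b x) + r d c (l a b x);
  rep_lm : forall a b c d x,
    l a b (m c d x) =
      m (br a b c) d x - r c d (l a b x) - l (br a b d) c x + m (br a b d) c x;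
  rep_lr : forall a b c d x,
    l a b (r c d x) =
      r c d (l a b x) - m (br a b c) d x - m (br a b d) c x + l (br a b d) c x;
  rep_m_right : forall a b c d x,
    m a (br b c d) x =
      r c d (m a b x) - r b d (m a c x) - r b c (m a d x) + r c b (m a d x);
  rep_r_right : forall a b c d x,
    r a (br b c d) x =
      r c d (r a b x) - r b d (r a c x) - r b c (r a d x) + r c b (r a d x) }.

Section Cohomology.

Variables (F : fieldType) (L V : lmodType F).
Variables (br : L -> L -> L -> L) (r m l : L -> L -> {linear V -> V}).
Variable T : {linear V -> L}.

Definition brT (u v w : V) : V :=
  l (T u) (T v) w + m (T u) (T w) v + r (T v) (T w) u.

Definition relative_Rota_Baxter : Prop :=
  forall u v w, br (T u) (T v) (T w) = T (brT u v w).

Definition lT (u v : V) (x : L) : L :=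
  br (T u) (T v) x - T (r (T v) x u + m (T u) x v).

Definition mT (u v : V) (x : L) : L :=
  br (T u) x (T v) - T (l (T u) x v + r x (T v) u).

Definition rT (u v : V) (x : L) : L :=
  br x (T u) (T v) - T (l x (T u) v + m x (T v) u).

Definition d1 (f : V -> L) (v1 v2 v3 : V) : L :=
  rT v2 v3 (f v1) + mT v1 v3 (f v2) + lT v1 v2 (f v3) - f (brT v1 v2 v3).

Definition d3_1 (g : V -> V -> V -> L) (v1 v2 v3 v4 v5 : V) : L :=
  g v1 v2 (brT v3 v4 v5) - g (brT v1 v2 v3) v4 v5 + g (brT v1 v2 v4) v3 v5
  + g (brT v1 v2 v5) v3 v4 - g (brT v1 v2 v5) v4 v3
  + lT v1 v2 (g v3 v4 v5) - rT v4 v5 (g v1 v2 v3) + rT v3 v5 (g v1 v2 v4)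
  + rT v3 v4 (g v1 v2 v5) - rT v4 v3 (g v1 v2 v5).

Definition d3_2 (g : V -> V -> V -> L) (v1 v2 v3 v4 v5 : V) : L :=
  g v1 (brT v2 v3 v4) v5 - g (brT v1 v2 v3) v4 v5 + g (brT v1 v3 v2) v4 v5
  + g (brT v1 v4 v2) v3 v5 - g (brT v1 v4 v3) v2 v5
  + mT v1 v5 (g v2 v3 v4) - rT v4 v5 (g v1 v2 v3) + rT v4 v5 (g v1 v3 v2)
  + rT v3 v5 (g v1 v4 v2) - rT v2 v5 (g v1 v4 v3).

(* Membership in Z^3_T. *)
Definition cocycle3 (g : V -> V -> V -> L) : Prop :=
  [/\ trilinear g,
      forall v1 v2 v3 v4 v5, d3_1 g v1 v2 v3 v4 v5 = 0
    & forall v1 v2 v3 v4 v5, d3_2 g v1 v2 v3 v4 v5 = 0].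

(* Membership in B^3_T, i.e. triviality of the class of g in Z^3_T / B^3_T. *)
Definition coboundary3 (g : V -> V -> V -> L) : Prop :=
  exists f : {linear V -> L}, forall u v w, g u v w = d1 f u v w.

End Cohomology.

(* W[[t]]/(t^{n+1}), an element being the tuple of its n+1 coefficients. *)
Notation trunc n W := {ffun 'I_n.+1 -> W}.

Definition trunc_const (n : nat) (W : nmodType) (w : W) : trunc n W :=
  [ffun s => if s == ord0 then w else 0].

Definition trunc_ext3 (n : nat) (A B C D : nmodType) (p : A -> B -> C -> D)
    (x : trunc n A) (y : trunc n B) (z : trunc n C) : trunc n D :=
  [ffun s : 'I_n.+1 =>
    \sum_(i < n.+1) \sum_(j < n.+1) \sum_(k < n.+1 | (i + j + k == s)%N)
      p (x i) (y j) (z k)].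

Section Deformation.

Variables (F : fieldType) (L V : lmodType F).
Variables (br : L -> L -> L -> L) (r m l : L -> L -> {linear V -> V}).

(* The F[[t]]/(t^{n+1})-linear map induced by \sum_i Tt i * t^i. *)
Definition trunc_map (n : nat) (Tt : 'I_n.+1 -> {linear V -> L})
    (x : trunc n V) : trunc n L :=
  [ffun s : 'I_n.+1 =>
    \sum_(i < n.+1) \sum_(j < n.+1 | (i + j == s)%N) Tt i (x j)].

Definition deformation (T : {linear V -> L}) (n : nat)
    (Tt : 'I_n.+1 -> {linear V -> L}) : Prop :=
  Tt ord0 =1 T /\
  forall u v w : V,
    let cu := trunc_const n u in
    let cv := trunc_const n v in
    let cw := trunc_const n w in
    let Tu := trunc_map Tt cu in
    let Tv := trunc_map Tt cv in
    let Tw := trunc_map Tt cw in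
    trunc_ext3 br Tu Tv Tw =
      trunc_map Tt (trunc_ext3 (fun a b => l a b : V -> V) Tu Tv cw
                    + trunc_ext3 (fun a b => m a b : V -> V) Tu Tw cv
                    + trunc_ext3 (fun a b => r a b : V -> V) Tv Tw cu).

(* The coefficients of \sum_(i <= n) Tt i * t^i + f * t^{n+1}. *)
Definition extend_by (n : nat) (Tt : 'I_n.+1 -> {linear V -> L})
    (f : {linear V -> L}) : 'I_n.+2 -> {linear V -> L} :=
  fun i => if unlift ord_max i is Some j then Tt j else f.

Definition extendable (T : {linear V -> L}) (n : nat)
    (Tt : 'I_n.+1 -> {linear V -> L}) : Prop :=
  exists f : {linear V -> L}, deformation T (extend_by Tt f).

Definition Ob (n : nat) (Tt : 'I_n.+1 -> {linear V -> L}) (u v w : V) : L :=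
  \sum_(i < n.+1) \sum_(j < n.+1) \sum_(k < n.+1 | (i + j + k == n.+1)%N)
    (br (Tt i u) (Tt j v) (Tt k w)
     - Tt i (l (Tt j u) (Tt k v) w + m (Tt k u) (Tt j w) v
             + r (Tt j v) (Tt k w) u)).

End Deformation.

(* Main.v *)
From HB Require Import structures.
Require Import Defs.
From mathcomp Require Import all_boot all_order all_algebra.
From mathcomp Require Import zify.

Set Implicit Arguments.
Unset Strict Implicit.
Unset Printing Implicit Defensive.

Import GRing.Theory.
Local Open Scope ring_scope.

(** For a linear map T : V -> L, Rota-Baxter or not, let
    E_T(u, v, w) = {Tu, Tv, Tw} - T(brT u v w) be its defect ([defect]), so that
    T is a relative Rota-Baxter operator iff E_T = 0.

    The heart of the proof is a Bianchi identity: the two coboundaries of E_T,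
    formed with T itself, vanish for every linear T ([d3_1_defect],
    [d3_2_defect]).  Indeed L x V is a Leibniz triple system for the semidirect
    product bracket; put X v = (T v, v) and P (a, y) = a - T y.  Then
    E_T(u, v, w) = P{X u, X v, X w}, and since
    {X u, X v, X w} = X (brT u v w) + (E_T(u, v, w), 0), a pair of summands such
    as E_T(v1, v2, brT v3 v4 v5) + l_T(v1, v2) E_T(v3, v4, v5) is the single
    nested bracket P{X v1, X v2, {X v3, X v4, X v5}} ([defect_lT], [defect_mT],
    [defect_rT]).  The coboundaries of E_T are therefore P applied to the two
    defining identities of the Leibniz triple system L x V.

    Apply this after base change to truncated power series.  The structures on
    L[[t]]/(t^{n+2}) and V[[t]]/(t^{n+2}) are again a Leibniz triple system and
    a representation ([trunc_lts], [trunc_rep]), because the axioms are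
    multilinear and hold on monomials.  An order n deformation, continued by the
    coefficient 0 at t^{n+1}, is a linear map T_t whose defect vanishes modulo
    t^{n+1} and has Ob_T as its coefficient at t^{n+1}; being t-linear, this
    defect is (x, y, z) |-> t^{n+1} Ob_T(x_0, y_0, z_0) ([defect_extend0]).
    Multiplication by t^{n+1} kills all higher coefficients, so the Bianchi
    identity for T_t is t^{n+1} times the cocycle condition for Ob_T
    ([Ob_cocycle]).  If the continuation uses f instead of 0 at t^{n+1}, the
    defect becomes t^{n+1} (Ob_T + d1 f) ([defect_extend]): the deformation
    extends through f iff Ob_T = d1 (- f). *)

(** * Deciding equations in abelian groups *)

(** The identities below have dozens of signed terms in a module, where no ring
    multiplication is available.  They are settled by reflection: two formal
    combinations of atoms agree as soon as their integer coefficients do. *)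
Inductive zexpr := ZVar of nat | ZZero | ZAdd of zexpr & zexpr | ZOpp of zexpr.

Fixpoint zeval (A : zmodType) (env : seq A) (e : zexpr) : A :=
  match e with
  | ZVar i => nth 0 env i
  | ZZero => 0
  | ZAdd e1 e2 => zeval env e1 + zeval env e2
  | ZOpp e1 => - zeval env e1
  end.

Fixpoint zcoef (e : zexpr) (i : nat) : int :=
  match e with
  | ZVar j => (i == j)%:R
  | ZZero => 0
  | ZAdd e1 e2 => zcoef e1 i + zcoef e2 i
  | ZOpp e1 => - zcoef e1 i
  end.

Lemma zevalE (A : zmodType) (env : seq A) (e : zexpr) :
  zeval env e = \sum_(i < size env) env`_i *~ zcoef e i.
Proof.
elim: e => [j||e1 IH1 e2 IH2|e1 IH1] /=.
- case: (ltnP j (size env)) => hj.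
    rewrite (bigD1 (Ordinal hj)) //= eqxx big1 ?addr0 // => i.
    by rewrite -val_eqE /= => /negbTE ->.
  rewrite nth_default // big1 // => i _.
  by rewrite ltn_eqF // (leq_trans (ltn_ord i)).
- by rewrite big1 // => i _; rewrite mulr0z.
- by rewrite IH1 IH2 -big_split; apply: eq_bigr => i _; rewrite mulrzDr.
- by rewrite IH1 -sumrN; apply: eq_bigr => i _; rewrite mulrNz.
Qed.

Lemma zeval_eq (A : zmodType) (env : seq A) (e1 e2 : zexpr) :
  all (fun i => zcoef e1 i == zcoef e2 i) (iota 0 (size env)) ->
  zeval env e1 = zeval env e2.
Proof.
move/allP=> h; rewrite !zevalE; apply: eq_bigr => i _.
by rewrite (eqP (h i _)) // mem_iota /=.
Qed.

Ltac zmod_index x env :=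
  lazymatch env with
  | x :: _ => constr:(0%N)
  | _ :: ?env' => let i := zmod_index x env' in constr:(S i)
  end.
Ltac zmod_atoms e env :=
  lazymatch e with
  | ?a + ?b => let env' := zmod_atoms a env in zmod_atoms b env'
  | - ?a => zmod_atoms a env
  | 0 => env
  | _ => match env with
         | _ => let i := zmod_index e env in env
         | _ => constr:(e :: env)
         end
  end.
Ltac zmod_reify e env :=
  lazymatch e with
  | ?a + ?b => let a' := zmod_reify a env in
               let b' := zmod_reify b env in constr:(ZAdd a' b')
  | - ?a => let a' := zmod_reify a env in constr:(ZOpp a')
  | 0 => constr:(ZZero)
  | _ => let i := zmod_index e env in constr:(ZVar i)
  end.
Ltac zmodule :=
  lazymatch goal with
  | |- @eq ?A ?a ?b =>
    let env := zmod_atoms a (@nil A) in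
    let env := zmod_atoms b env in
    let a' := zmod_reify a env in
    let b' := zmod_reify b env in
    exact: (@zeval_eq _ env a' b' (erefl true))
  end.

(** * Linear and trilinear maps *)

Section Linear.

Variables (F : fieldType) (U W : lmodType F).

Lemma linear_bundle (f : U -> W) :
  linear f -> exists g : {linear U -> W}, f =1 g.
Proof.
move=> hf.
pose g : {linear U -> W} := HB.pack f (GRing.isLinear.Build F U W *:%R f hf).
by exists g.
Qed.

Lemma lin0 (f : U -> W) : linear f -> f 0 = 0.
Proof. by case/linear_bundle=> g fg; rewrite fg linear0. Qed.

Lemma linD (f : U -> W) x y : linear f -> f (x + y) = f x + f y.
Proof. by case/linear_bundle=> g fg; rewrite !fg linearD. Qed.

Lemma linN (f : U -> W) x : linear f -> f (- x) = - f x.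
Proof. by case/linear_bundle=> g fg; rewrite !fg linearN. Qed.

Lemma lin_sum (f : U -> W) I (s : seq I) (P : pred I) G :
  linear f -> f (\sum_(i <- s | P i) G i) = \sum_(i <- s | P i) f (G i).
Proof.
case/linear_bundle=> g fg; rewrite fg linear_sum.
by apply: eq_bigr => i _; rewrite fg.
Qed.

Lemma linear_id : linear (@id U).
Proof. by []. Qed.

Lemma linear_add (f g : U -> W) :
  linear f -> linear g -> linear (fun x => f x + g x).
Proof. by move=> hf hg k x y; rewrite hf hg scalerDr addrACA. Qed.

Lemma linear_opp (f : U -> W) : linear f -> linear (fun x => - f x).
Proof. by move=> hf k x y; rewrite hf opprD scalerN. Qed.

Lemma linear_comp (X : lmodType F) (f : U -> W) (g : W -> X) :
  linear f -> linear g -> linear (fun x => g (f x)).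
Proof. by move=> hf hg k x y; rewrite hf hg. Qed.

End Linear.

Lemma trilinear_End (F : fieldType) (L V : lmodType F)
    (p : L -> L -> {linear V -> V}) :
  bilinear_End p -> trilinear (fun a b => p a b : V -> V).
Proof. by case=> h1 h2; split=> // a b k x y; rewrite linearP. Qed.

Lemma trilinearD (F : fieldType) (A B C D : lmodType F)
    (p : A -> B -> C -> D) : trilinear p ->
  (forall a a' b c, p (a + a') b c = p a b c + p a' b c) *
  (forall a b b' c, p a (b + b') c = p a b c + p a b' c) *
  (forall a b c c', p a b (c + c') = p a b c + p a b c').
Proof.
case=> h1 h2 h3; split; [split|] => *.
- exact: (linD _ _ (h1 _ _)).
- exact: (linD _ _ (h2 _ _)).
- exact: (linD _ _ (h3 _ _)).
Qed.

Lemma trilinearN (F : fieldType) (A B C D : lmodType F)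
    (p : A -> B -> C -> D) : trilinear p ->
  (forall a b c, p (- a) b c = - p a b c) *
  (forall a b c, p a (- b) c = - p a b c) *
  (forall a b c, p a b (- c) = - p a b c).
Proof.
case=> h1 h2 h3; split; [split|] => *.
- exact: (linN _ (h1 _ _)).
- exact: (linN _ (h2 _ _)).
- exact: (linN _ (h3 _ _)).
Qed.

Lemma bilinear_EndD (F : fieldType) (L V : lmodType F)
    (p : L -> L -> {linear V -> V}) : bilinear_End p ->
  (forall a a' b x, p (a + a') b x = p a b x + p a' b x) *
  (forall a b b' x, p a (b + b') x = p a b x + p a b' x) *
  (forall a b x y, p a b (x + y) = p a b x + p a b y).
Proof. by move/trilinear_End/trilinearD. Qed.

Lemma bilinear_EndN (F : fieldType) (L V : lmodType F)
    (p : L -> L -> {linear V -> V}) : bilinear_End p ->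
  (forall a b x, p (- a) b x = - p a b x) *
  (forall a b x, p a (- b) x = - p a b x) *
  (forall a b x, p a b (- x) = - p a b x).
Proof. by move/trilinear_End/trilinearN. Qed.

Section Slots.
Variables (F : fieldType) (A B C D U : lmodType F) (p : A -> B -> C -> D).
Hypothesis hp : trilinear p.

Lemma trilinear_comp1 (f : U -> A) b c :
  linear f -> linear (fun x => p (f x) b c).
Proof. by case: hp => h _ _ hf k x y; rewrite hf h. Qed.

Lemma trilinear_comp2 (f : U -> B) a c :
  linear f -> linear (fun x => p a (f x) c).
Proof. by case: hp => _ h _ hf k x y; rewrite hf h. Qed.

Lemma trilinear_comp3 (f : U -> C) a b :
  linear f -> linear (fun x => p a b (f x)).
Proof. by case: hp => _ _ h hf k x y; rewrite hf h. Qed.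

Lemma trilinear0 :
  (forall b c, p 0 b c = 0) * (forall a c, p a 0 c = 0)
  * (forall a b, p a b 0 = 0).
Proof.
case: hp => h1 h2 h3; split; [split|] => *.
- exact: (lin0 (h1 _ _)).
- exact: (lin0 (h2 _ _)).
- exact: (lin0 (h3 _ _)).
Qed.

End Slots.

(** * The Bianchi identity for the defect of a linear map *)

Section Bianchi.

Variables (F : fieldType) (L V : lmodType F).
Variables (br : L -> L -> L -> L) (r m l : L -> L -> {linear V -> V}).
Variable T : {linear V -> L}.

Definition defect (u v w : V) : L :=
  br (T u) (T v) (T w) - T (brT r m l T u v w).

Hypotheses (hL : leibniz_triple_system br) (hV : lts_representation br r m l).

Let brD := trilinearD (lts_trilinear hL).
Let brN := trilinearN (lts_trilinear hL).
Let rD := bilinear_EndD (rep_r_bilinear hV).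
Let rN := bilinear_EndN (rep_r_bilinear hV).
Let mD := bilinear_EndD (rep_m_bilinear hV).
Let mN := bilinear_EndN (rep_m_bilinear hV).
Let lD := bilinear_EndD (rep_l_bilinear hV).
Let lN := bilinear_EndN (rep_l_bilinear hV).
Let TD x y : T (x + y) = T x + T y. Proof. exact: linearD. Qed.
Let TN x : T (- x) = - T x. Proof. exact: linearN. Qed.
Let linE := (brD, brN, rD, rN, mD, mN, lD, lN, TD, TN).

(** In this lemma and the next two, the right-hand side is the image under
    P : (a, y) |-> a - T y of a semidirect product bracket in which one argument
    is (a, y) and the others are of the form (T v, v).  It splits because
    (a, y) = (T y, y) + (a - T y, 0). *)
Lemma defect_lT v1 v2 a y :
  defect v1 v2 y + lT br r m T v1 v2 (a - T y) =
  br (T v1) (T v2) a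
  - T (l (T v1) (T v2) y + m (T v1) a v2 + r (T v2) a v1).
Proof.
rewrite /defect /lT /brT !linE.
zmodule.
Qed.

Lemma defect_mT v1 v3 a y :
  defect v1 y v3 + mT br r l T v1 v3 (a - T y) =
  br (T v1) a (T v3)
  - T (l (T v1) a v3 + m (T v1) (T v3) y + r a (T v3) v1).
Proof.
rewrite /defect /mT /brT !linE.
zmodule.
Qed.

Lemma defect_rT v2 v3 a y :
  defect y v2 v3 + rT br m l T v2 v3 (a - T y) =
  br a (T v2) (T v3)
  - T (l a (T v2) v3 + m a (T v3) v2 + r (T v2) (T v3) y).
Proof.
rewrite /defect /rT /brT !linE.
zmodule.
Qed.

(** After pairing, the L-component is the first axiom of the triple system and
    the V-component follows from the five axioms of the representation that
    arise from it, one for each position of a vector of V. *)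
Lemma d3_1_defect v1 v2 v3 v4 v5 :
  d3_1 br r m l T defect v1 v2 v3 v4 v5 = 0.
Proof.
set E := defect; set b := brT r m l T.
(* Pair each value of E at a bracket with the matching action on E. *)
transitivity
 ((E v1 v2 (b v3 v4 v5) + lT br r m T v1 v2 (E v3 v4 v5))
  - (E (b v1 v2 v3) v4 v5 + rT br m l T v4 v5 (E v1 v2 v3))
  + (E (b v1 v2 v4) v3 v5 + rT br m l T v3 v5 (E v1 v2 v4))
  + (E (b v1 v2 v5) v3 v4 + rT br m l T v3 v4 (E v1 v2 v5))
  - (E (b v1 v2 v5) v4 v3 + rT br m l T v4 v3 (E v1 v2 v5))).
  by rewrite /d3_1 -/b; zmodule.
rewrite !(defect_lT, defect_rT) (lts_right hL) /b /brT !linE.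
rewrite (rep_ll hV) (rep_lm hV) (rep_lr hV) (rep_m_right hV) (rep_r_right hV).
by rewrite !linE; zmodule.
Qed.

(** The same argument with the second axiom of the triple system and the other
    five axioms of the representation. *)
Lemma d3_2_defect v1 v2 v3 v4 v5 :
  d3_2 br r m l T defect v1 v2 v3 v4 v5 = 0.
Proof.
set E := defect; set b := brT r m l T.
(* Pair each value of E at a bracket with the matching action on E. *)
transitivity
 ((E v1 (b v2 v3 v4) v5 + mT br r l T v1 v5 (E v2 v3 v4))
  - (E (b v1 v2 v3) v4 v5 + rT br m l T v4 v5 (E v1 v2 v3))
  + (E (b v1 v3 v2) v4 v5 + rT br m l T v4 v5 (E v1 v3 v2))
  + (E (b v1 v4 v2) v3 v5 + rT br m l T v3 v5 (E v1 v4 v2))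
  - (E (b v1 v4 v3) v2 v5 + rT br m l T v2 v5 (E v1 v4 v3))).
  by rewrite /d3_2 -/b; zmodule.
rewrite !(defect_mT, defect_rT) (lts_middle hL) /b /brT !linE.
rewrite (rep_l_middle hV) (rep_ml hV) (rep_mm hV) (rep_mr hV) (rep_r_middle hV).
by rewrite !linE; zmodule.
Qed.

End Bianchi.

(** * Monomials in truncated power series *)

(** The monomial w t^k; the exponent ranges over all of nat, and the monomial is
    0 beyond the truncation order, so that exponents can be added freely. *)
Definition mono (W : nmodType) (n k : nat) (w : W) : trunc n W :=
  [ffun s : 'I_n.+1 => w *+ (s == k :> nat)].
Arguments mono {W n} k w.

Section Mono.

Variables (F : fieldType) (n : nat).
Implicit Types U W : lmodType F.

Lemma mono_linear W k : linear (mono k : W -> trunc n W).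
Proof.
by move=> a x y; apply/ffunP=> s; rewrite !ffunE mulrnDl scalerMnr.
Qed.

Lemma monoD W k (x y : W) : mono k (x + y) = mono k x + mono k y :> trunc n W.
Proof. exact: linD (mono_linear _). Qed.

Lemma monoN W k (x : W) : mono k (- x) = - mono k x :> trunc n W.
Proof. exact: linN (mono_linear _). Qed.

Lemma mono_out W k (w : W) : (n < k)%N -> mono k w = 0 :> trunc n W.
Proof.
move=> hk; apply/ffunP=> s; rewrite !ffunE ltn_eqF //.
exact: leq_ltn_trans (leq_ord s) hk.
Qed.

Lemma trunc_constE W (w : W) : trunc_const n w = mono 0 w.
Proof. by apply/ffunP=> s; rewrite !ffunE -val_eqE /=; case: eqP. Qed.

Lemma mono_sum W (x : trunc n W) : x = \sum_(i < n.+1) mono i (x i).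
Proof.
apply/ffunP=> s; rewrite sum_ffunE (bigD1 s) //= !ffunE eqxx big1 ?addr0 //.
by move=> i /negbTE hi; rewrite ffunE val_eqE eq_sym hi.
Qed.

Lemma linear_mono_ext U W (f g : trunc n U -> W) :
    linear f -> linear g -> (forall i a, f (mono i a) = g (mono i a)) ->
  f =1 g.
Proof.
move=> hf hg fg x.
rewrite (mono_sum x) (lin_sum _ _ _ hf) (lin_sum _ _ _ hg).
by apply: eq_bigr.
Qed.

(** * Base change of operations to truncated power series *)

Section Ext3.
Variables (A B C D : lmodType F) (p : A -> B -> C -> D).
Hypothesis hp : trilinear p.

Lemma trunc_ext3_trilinear : trilinear (trunc_ext3 p (n := n)).
Proof.
case: hp => h1 h2 h3; split=> [y z|x z|x y] k u v; apply/ffunP=> s;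
  rewrite !ffunE !scaler_sumr -big_split /=; apply: eq_bigr => i _;
  rewrite !scaler_sumr -big_split /=; apply: eq_bigr => j _;
  rewrite !scaler_sumr -big_split /=; apply: eq_bigr => c _;
  by rewrite !ffunE ?h1 ?h2 ?h3.
Qed.

Lemma trunc_ext3_mono i j k a b c :
  trunc_ext3 p (mono i a) (mono j b) (mono k c)
  = mono (i + j + k) (p a b c) :> trunc n D.
Proof.
have h0 := trilinear0 trunc_ext3_trilinear.
have [hi|hi] := ltnP n i; first by rewrite (mono_out a hi) h0 mono_out //; lia.
have [hj|hj] := ltnP n j; first by rewrite (mono_out b hj) h0 mono_out //; lia.
have [hk|hk] := ltnP n k; first by rewrite (mono_out c hk) h0 mono_out //; lia.
apply/ffunP=> s; rewrite !ffunE.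
have z0 := trilinear0 hp.
pose i' := Ordinal (hi : (i < n.+1)%N); pose j' := Ordinal (hj : (j < n.+1)%N).
pose k' := Ordinal (hk : (k < n.+1)%N).
rewrite (bigD1 i') //= [X in _ + X]big1 ?addr0; last first.
  move=> a' /negbTE ha; apply: big1 => b' _; apply: big1 => c' _.
  by rewrite ffunE -[i]/(val i') val_eqE ha z0.
rewrite (bigD1 j') //= [X in _ + X]big1 ?addr0; last first.
  move=> b' /negbTE hb; apply: big1 => c' _.
  by rewrite [mono j b _]ffunE -[j]/(val j') val_eqE hb z0.
rewrite big_mkcond (bigD1 k') //= [X in _ + X]big1 ?addr0; last first.
  move=> c' /negbTE hc.
  by rewrite [mono k c _]ffunE -[k]/(val k') val_eqE hc z0 if_same.
by rewrite !ffunE !eqxx eq_sym; case: eqP.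
Qed.

End Ext3.

Section TruncMap.
Variables (L V : lmodType F) (Tt : 'I_n.+1 -> {linear V -> L}).

Lemma trunc_map_linear : linear (trunc_map Tt).
Proof.
move=> k u v; apply/ffunP=> s; rewrite !ffunE !scaler_sumr -big_split /=.
apply: eq_bigr => i _; rewrite !scaler_sumr -big_split /=.
by apply: eq_bigr => j _; rewrite !ffunE linearP.
Qed.

HB.instance Definition _ :=
  GRing.isLinear.Build F (trunc n V) (trunc n L) *:%R (trunc_map Tt)
    trunc_map_linear.

Lemma trunc_map_mono k v :
  trunc_map Tt (mono k v) = \sum_(i < n.+1) mono (i + k) (Tt i v).
Proof.
have [hk|hk] := ltnP n k.
  rewrite mono_out // linear0 big1 // => i _; rewrite mono_out //; lia.
apply/ffunP=> s; rewrite sum_ffunE !ffunE; apply: eq_bigr => i _.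
pose k' := Ordinal (hk : (k < n.+1)%N).
rewrite big_mkcond (bigD1 k') //= [X in _ + X]big1 ?addr0; last first.
  move=> c' /negbTE hc.
  by rewrite ffunE -[k]/(val k') val_eqE hc linear0 if_same.
by rewrite !ffunE eqxx eq_sym; case: eqP.
Qed.

End TruncMap.

Section TruncAct.
Variables (L V : lmodType F) (p : L -> L -> {linear V -> V}).

(** The base-changed action has to be bundled as a linear endomorphism of the
    truncated series before it can be part of a representation. *)
Definition trunc_act (x y : trunc n L) : trunc n V -> trunc n V :=
  trunc_ext3 (fun a b => p a b : V -> V) x y.

Lemma trunc_act_linear x y : linear (trunc_act x y).
Proof.
move=> k u v; apply/ffunP=> s; rewrite !ffunE !scaler_sumr -big_split /=.
apply: eq_bigr => i _; rewrite !scaler_sumr -big_split /=.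
apply: eq_bigr => j _; rewrite !scaler_sumr -big_split /=.
by apply: eq_bigr => c _; rewrite !ffunE linearP.
Qed.

HB.instance Definition _ x y :=
  GRing.isLinear.Build F (trunc n V) (trunc n V) *:%R (trunc_act x y)
    (trunc_act_linear x y).

Definition trunc_End (x y : trunc n L) : {linear trunc n V -> trunc n V} :=
  trunc_act x y.

End TruncAct.
End Mono.

Lemma trilinear_mono_ext (F : fieldType) n (A B C D : lmodType F)
    (q q' : trunc n A -> trunc n B -> trunc n C -> D) :
    trilinear q -> trilinear q' ->
    (forall i j k a b c, q (mono i a) (mono j b) (mono k c)
                         = q' (mono i a) (mono j b) (mono k c)) ->
  forall x y z, q x y z = q' x y z.
Proof.
move=> [q1 q2 q3] [p1 p2 p3] qp x y z; move: x.
apply: linear_mono_ext => // i a; move: y.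
apply: linear_mono_ext => // j b; move: z.
by apply: linear_mono_ext => // k c; apply: qp.
Qed.

(** Proves that an expression built from sums, opposites and trilinear
    operations of the context is linear in a variable occurring once in each
    term.  The slot of the variable is found by trial, so that matching has to
    backtrack. *)
Ltac linear_slot :=
  match goal with
  | |- linear (fun x => x) => exact: linear_id
  | |- linear (fun x => @?f x + @?g x) =>
    refine (@linear_add _ _ _ f g _ _); linear_slot
  | |- linear (fun x => - @?f x) => refine (@linear_opp _ _ _ f _); linear_slot
  | |- linear (fun x => ?p (@?f x) ?b ?c) =>
    refine (@trilinear_comp1 _ _ _ _ _ _ p _ f b c _); [by [] | linear_slot]
  | |- linear (fun x => ?p ?a (@?f x) ?c) =>
    refine (@trilinear_comp2 _ _ _ _ _ _ p _ f a c _); [by [] | linear_slot]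
  | |- linear (fun x => ?p ?a ?b (@?f x)) =>
    refine (@trilinear_comp3 _ _ _ _ _ _ p _ f a b _); [by [] | linear_slot]
  | |- linear (?p ?a ?b) =>
    refine (@trilinear_comp3 _ _ _ _ _ _ p _ id a b _);
      [by [] | exact: linear_id]
  end.

(** Reduces an equation linear in x to the case where x is a monomial. *)
Ltac on_mono x :=
  match goal with |- ?u = ?v =>
    let fu := eval pattern x in u in
    let fv := eval pattern x in v in
    match fu with ?f _ => match fv with ?g _ =>
      refine (@linear_mono_ext _ _ _ _ f g _ _ _ x); [linear_slot|linear_slot|]
    end end
  end; clear x; intros ? x.

(** The terms of an axiom add the exponents in different orders; after they are
    made literally equal, the monomial is pulled out by additivity. *)
Ltac equal_degrees :=
  lazymatch goal with |- mono ?s _ = _ =>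
    repeat match goal with |- context [mono ?k ?w] =>
      assert_fails (constr_eq k s); rewrite (_ : k = s); [|lia] end
  end.

(** The axioms are 5-linear, so it is enough to compare monomials; there the sum
    of the exponents is the same in all terms and factors out. *)
Lemma trunc_lts (F : fieldType) (L : lmodType F) (n : nat) 
  (br : L -> L -> L -> L) :
  leibniz_triple_system br ->
  leibniz_triple_system (trunc_ext3 br (n := n)).
Proof.
move=> hL; have hbr := lts_trilinear hL.
have hbr' := trunc_ext3_trilinear n hbr.
split=> // a b c d e.
- on_mono a; on_mono b; on_mono c; on_mono d; on_mono e.
  rewrite !trunc_ext3_mono //.
  equal_degrees.
  by rewrite (lts_right hL) !(monoD, monoN).
- on_mono a; on_mono b; on_mono c; on_mono d; on_mono e.
  rewrite !trunc_ext3_mono //.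
  equal_degrees.
  by rewrite (lts_middle hL) !(monoD, monoN).
Qed.

Lemma trunc_rep (F : fieldType) (L V : lmodType F) (n : nat) 
  (br : L -> L -> L -> L) (r m l : L -> L -> {linear V -> V}) :
  leibniz_triple_system br -> lts_representation br r m l ->
  lts_representation (trunc_ext3 br (n := n))
    (trunc_End (n := n) r) (trunc_End m) (trunc_End l).
Proof.
move=> hL hV; have hbr := lts_trilinear hL.
have hbr' := trunc_ext3_trilinear n hbr.
have hr := trilinear_End (rep_r_bilinear hV).
have hm := trilinear_End (rep_m_bilinear hV).
have hl := trilinear_End (rep_l_bilinear hV).
have hr' := trunc_ext3_trilinear n hr.
have hm' := trunc_ext3_trilinear n hm.
have hl' := trunc_ext3_trilinear n hl.
split=> [|||a b c d e|a b c d e|a b c d e|a b c d e|a b c d e|a b c d e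
        |a b c d e|a b c d e|a b c d e|a b c d e].
- by case: hr' => ? ? _; split.
- by case: hm' => ? ? _; split.
- by case: hl' => ? ? _; split.
all: rewrite /trunc_End /= /trunc_act.
all: on_mono a; on_mono b; on_mono c; on_mono d; on_mono e.
all: rewrite !trunc_ext3_mono //.
all: equal_degrees.
all: rewrite -!monoN -!monoD; congr mono.
- exact: rep_l_middle hV _ _ _ _ _.
- exact: rep_ml hV _ _ _ _ _.
- exact: rep_mm hV _ _ _ _ _.
- exact: rep_mr hV _ _ _ _ _.
- exact: rep_r_middle hV _ _ _ _ _.
- exact: rep_ll hV _ _ _ _ _.
- exact: rep_lm hV _ _ _ _ _.
- exact: rep_lr hV _ _ _ _ _.
- exact: rep_m_right hV _ _ _ _ _.
- exact: rep_r_right hV _ _ _ _ _.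
Qed.

(** * Multiplication by powers of t, constant and top coefficients *)

Section Leading.

Variables (F : fieldType) (n : nat).
Implicit Types U W : lmodType F.

Lemma coef_linear W (s : 'I_n.+1) : linear (fun x : trunc n W => x s).
Proof. by move=> k x y; rewrite !ffunE. Qed.

Lemma mono_coef0 W k (w : W) :
  (mono k w : trunc n W) ord0 = if k == 0%N then w else 0.
Proof. by rewrite ffunE eq_sym; case: (k == 0%N). Qed.

Lemma mono_top W k (w : W) :
  mono (n + k) w = mono n (if k == 0%N then w else 0) :> trunc n W.
Proof.
case: k => [|k]; first by rewrite addn0.
by rewrite mono_out ?(lin0 (mono_linear _ _)) //; lia.
Qed.

Lemma mono_top_inj W (w : W) : mono n w = 0 :> trunc n W -> w = 0.
Proof. by move/ffunP/(_ ord_max); rewrite !ffunE eqxx. Qed.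

(** Multiplication by t^d.  That an operation commutes with all shifts is its
    linearity over the truncated power series ring. *)
Definition shift W d (x : trunc n W) : trunc n W :=
  \sum_(i < n.+1) mono (i + d) (x i).

Lemma shift_linear W d : linear (@shift W d).
Proof.
move=> k x y; rewrite scaler_sumr -big_split; apply: eq_bigr => i _.
by rewrite !ffunE mono_linear.
Qed.

Lemma shift_mono W d k (w : W) :
  shift d (mono k w : trunc n W) = mono (k + d) w.
Proof.
rewrite /shift; have [hk|hk] := ltnP n k.
  rewrite (mono_out w hk) mono_out ?big1 // => [i _|]; last by lia.
  by rewrite ffunE (lin0 (mono_linear _ _)).
pose k' := Ordinal (hk : (k < n.+1)%N).
rewrite (bigD1 k') //= [X in _ + X]big1 ?addr0 ?ffunE ?eqxx // => i /negbTE hi.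
by rewrite ffunE -[k]/(val k') val_eqE hi (lin0 (mono_linear _ _)).
Qed.

Lemma shift_top W (x : trunc n W) : shift n x = mono n (x ord0).
Proof.
rewrite /shift big_ord_recl big1 ?addr0 // => i _.
by rewrite mono_out //= /bump; lia.
Qed.

Section Ext3.
Variables (A B C D : lmodType F) (p : A -> B -> C -> D).
Hypothesis hp : trilinear p.

Lemma trunc_ext3_coef0 (x : trunc n A) (y : trunc n B) (z : trunc n C) :
  trunc_ext3 p x y z ord0 = p (x ord0) (y ord0) (z ord0).
Proof.
have neq0 (i : 'I_n.+1) : i != ord0 -> (i != 0 :> nat)%N by rewrite -val_eqE.
rewrite ffunE (bigD1 ord0) //= [X in _ + X]big1 ?addr0; last first.
  by move=> i /neq0 hi; apply: big1 => j _; apply: big1 => k; lia.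
rewrite (bigD1 ord0) //= [X in _ + X]big1 ?addr0; last first.
  by move=> i /neq0 hi; apply: big1 => j; lia.
rewrite (bigD1 ord0) //= [X in _ + X]big1 ?addr0 //.
by move=> i /andP[hi /neq0]; lia.
Qed.

Lemma trunc_ext3_shift d (x : trunc n A) (y : trunc n B) (z : trunc n C) :
  (trunc_ext3 p (shift d x) y z = shift d (trunc_ext3 p x y z)) *
  (trunc_ext3 p x (shift d y) z = shift d (trunc_ext3 p x y z)) *
  (trunc_ext3 p x y (shift d z) = shift d (trunc_ext3 p x y z)).
Proof.
have tp := trunc_ext3_trilinear n hp; have [t1 t2 t3] := tp.
have sl W := @shift_linear W d.
have sp : trilinear (fun x y z => shift d (trunc_ext3 p x y z)).
  by split=> *; apply: linear_comp (sl _).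
split; [split|].
- apply: (trilinear_mono_ext (q := fun x => trunc_ext3 p (shift d x)))
    sp _ _ _ _.
    split=> * //; exact: (linear_comp (sl _) (t1 _ _)).
  by move=> *; rewrite !(shift_mono, trunc_ext3_mono) //; congr mono; lia.
- apply: (trilinear_mono_ext (q := fun x y => trunc_ext3 p x (shift d y)))
    sp _ _ _ _.
    split=> * //; exact: (linear_comp (sl _) (t2 _ _)).
  by move=> *; rewrite !(shift_mono, trunc_ext3_mono) //; congr mono; lia.
- apply: (trilinear_mono_ext (q := fun x y z => trunc_ext3 p x y (shift d z)))
    sp _ _ _ _.
    split=> * //; exact: (linear_comp (sl _) (t3 _ _)).
  by move=> *; rewrite !(shift_mono, trunc_ext3_mono) //; congr mono; lia.
Qed.

(** The monomial of top degree n is t^n times a constant; t^n comes out, and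
    multiplication by t^n only sees constant coefficients. *)
Lemma trunc_ext3_top :
  (forall a (y : trunc n B) (z : trunc n C),
     trunc_ext3 p (mono n a) y z = mono n (p a (y ord0) (z ord0))) *
  (forall (x : trunc n A) b (z : trunc n C),
     trunc_ext3 p x (mono n b) z = mono n (p (x ord0) b (z ord0))) *
  (forall (x : trunc n A) (y : trunc n B) c,
     trunc_ext3 p x y (mono n c) = mono n (p (x ord0) (y ord0) c)).
Proof.
have tE W (w : W) : mono n w = shift n (mono 0 w : trunc n W).
  by rewrite shift_mono.
by split; [split|] => *;
  rewrite !tE !trunc_ext3_shift !shift_top !trunc_ext3_coef0 !mono_coef0.
Qed.

End Ext3.
End Leading.

Section TruncMapLeading.

Variables (F : fieldType) (n : nat) (L V : lmodType F).
Variable Tt : 'I_n.+1 -> {linear V -> L}.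

Lemma trunc_map_coef0 x : trunc_map Tt x ord0 = Tt ord0 (x ord0).
Proof.
have neq0 (i : 'I_n.+1) : i != ord0 -> (i != 0 :> nat)%N by rewrite -val_eqE.
rewrite ffunE (bigD1 ord0) //= [X in _ + X]big1 ?addr0; last first.
  by move=> i /neq0 hi; apply: big1 => j; lia.
rewrite (bigD1 ord0) //= [X in _ + X]big1 ?addr0 //.
by move=> i /andP[hi /neq0]; lia.
Qed.

Lemma trunc_map_shift d x :
  trunc_map Tt (shift d x) = shift d (trunc_map Tt x).
Proof.
move: x; apply: linear_mono_ext => [||k v].
- exact: (linear_comp (@shift_linear _ _ _ _) (@trunc_map_linear _ _ _ _ Tt)).
- exact: (linear_comp (@trunc_map_linear _ _ _ _ Tt) (@shift_linear _ _ _ _)).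
rewrite shift_mono !trunc_map_mono (lin_sum _ _ _ (@shift_linear _ _ _ _)).
by apply: eq_bigr => i _; rewrite shift_mono addnA.
Qed.

Lemma trunc_map_top v : trunc_map Tt (mono n v) = mono n (Tt ord0 v).
Proof.
have tE (W : lmodType F) (w : W) : mono n w = shift n (mono 0 w : trunc n W).
  by rewrite shift_mono.
by rewrite !tE trunc_map_shift !shift_top trunc_map_coef0 !mono_coef0.
Qed.

End TruncMapLeading.

(** * The defect of a truncated power series of linear maps *)

Lemma defect_trilinear (F : fieldType) (L V : lmodType F)
    (br : L -> L -> L -> L) (r m l : L -> L -> {linear V -> V})
    (T : {linear V -> L}) :
  trilinear br -> bilinear_End r -> bilinear_End m -> bilinear_End l ->
  trilinear (defect br r m l T).
Proof.
move=> hbr /trilinear_End hr /trilinear_End hm /trilinear_End hl.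
have hT : linear T by exact: linearP.
have hid := @linear_id _ V.
split=> x y; rewrite /defect /brT; apply: linear_add.
all: try by [ exact: (trilinear_comp1 hbr _ _ hT)
            | exact: (trilinear_comp2 hbr _ _ hT)
            | exact: (trilinear_comp3 hbr _ _ hT) ].
all: refine (linear_opp (linear_comp _ hT)); apply: linear_add;
  [apply: linear_add|].
- exact: (trilinear_comp1 hl _ _ hT).
- exact: (trilinear_comp1 hm _ _ hT).
- exact: (trilinear_comp3 hr _ _ hid).
- exact: (trilinear_comp2 hl _ _ hT).
- exact: (trilinear_comp3 hm _ _ hid).
- exact: (trilinear_comp1 hr _ _ hT).
- exact: (trilinear_comp3 hl _ _ hid).
- exact: (trilinear_comp2 hm _ _ hT).
- exact: (trilinear_comp2 hr _ _ hT).
Qed.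

Section TruncDefect.

Variables (F : fieldType) (L V : lmodType F).
Variables (br : L -> L -> L -> L) (r m l : L -> L -> {linear V -> V}).
Hypotheses (hL : leibniz_triple_system br) (hV : lts_representation br r m l).

Definition trunc_defect n (Tt : 'I_n.+1 -> {linear V -> L}) :=
  defect (trunc_ext3 br (n := n)) (trunc_End (n := n) r) (trunc_End m)
    (trunc_End l) (trunc_map Tt).

Lemma deformation_defect n (T : {linear V -> L})
    (Tt : 'I_n.+1 -> {linear V -> L}) :
  deformation br r m l T Tt <->
  Tt ord0 =1 T /\
  forall u v w, trunc_defect Tt (mono 0 u) (mono 0 v) (mono 0 w) = 0.
Proof.
split=> -[h0 h]; split=> // u v w.
  by apply/eqP; rewrite subr_eq0 -!trunc_constE; apply/eqP/h.
by have /eqP := h u v w; rewrite subr_eq0 -!trunc_constE => /eqP.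
Qed.

Lemma trunc_defect_trilinear n (Tt : 'I_n.+1 -> {linear V -> L}) :
  trilinear (trunc_defect Tt).
Proof.
have hVt := trunc_rep n hL hV.
apply: defect_trilinear.
- exact: lts_trilinear (trunc_lts n hL).
- exact: rep_r_bilinear hVt.
- exact: rep_m_bilinear hVt.
- exact: rep_l_bilinear hVt.
Qed.

Let hbr := lts_trilinear hL.
Let hr := trilinear_End (rep_r_bilinear hV).
Let hm := trilinear_End (rep_m_bilinear hV).
Let hl := trilinear_End (rep_l_bilinear hV).

(** The defect is linear over the truncated power series ring, so it is
    determined by its values on constants. *)
Lemma trunc_defect_shift n (Tt : 'I_n.+1 -> {linear V -> L}) d x y z :
  (trunc_defect Tt (shift d x) y z = shift d (trunc_defect Tt x y z)) *
  (trunc_defect Tt x (shift d y) z = shift d (trunc_defect Tt x y z)) *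
  (trunc_defect Tt x y (shift d z) = shift d (trunc_defect Tt x y z)).
Proof.
have sl W := @shift_linear F n W d.
have sD W x1 x2 := linD x1 x2 (sl W); have sN W x1 := linN x1 (sl W).
have brs := trunc_ext3_shift hbr; have rs := trunc_ext3_shift hr.
have ms := trunc_ext3_shift hm; have ls := trunc_ext3_shift hl.
rewrite /trunc_defect /defect /brT /trunc_End /= /trunc_act.
rewrite !(trunc_map_shift, brs, rs, ms, ls).
by rewrite -!sD !trunc_map_shift -!sN -!sD.
Qed.

Definition defect_term n (Tt : 'I_n.+1 -> {linear V -> L}) u v w
    (i j k : 'I_n.+1) : L :=
  br (Tt i u) (Tt j v) (Tt k w)
  - Tt i (l (Tt j u) (Tt k v) w + m (Tt k u) (Tt j w) v
          + r (Tt j v) (Tt k w) u).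

Lemma trunc_defect_const n (Tt : 'I_n.+1 -> {linear V -> L}) u v w s :
  trunc_defect Tt (mono 0 u) (mono 0 v) (mono 0 w) s =
  \sum_(i < n.+1) \sum_(j < n.+1) \sum_(k < n.+1 | (i + j + k == s)%N)
    defect_term Tt u v w i j k.
Proof.
have E3 := trunc_ext3_trilinear n.
have [br1 br2 br3] := E3 _ _ _ _ _ _ hbr.
have [r1 r2 r3] := E3 _ _ _ _ _ _ hr.
have [m1 m2 m3] := E3 _ _ _ _ _ _ hm.
have [l1 l2 l3] := E3 _ _ _ _ _ _ hl.
rewrite /trunc_defect /defect /brT /trunc_End /= /trunc_act.
(* In the m-term the index j belongs to w and k to u, as in the formula for
   Ob; so its two sums are expanded in the opposite order. *)
set act := (_ + _ + _).
have -> : act = \sum_(j < n.+1) \sum_(k < n.+1) mono (j + k)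
   (l (Tt j u) (Tt k v) w + m (Tt k u) (Tt j w) v + r (Tt j v) (Tt k w) u).
  rewrite {}/act !trunc_map_mono.
  rewrite (lin_sum _ _ _ (l1 _ _)) (lin_sum _ _ _ (m2 _ _)).
  rewrite (lin_sum _ _ _ (r1 _ _)).
  rewrite -!big_split; apply: eq_bigr => j _ /=.
  rewrite (lin_sum _ _ _ (l2 _ _)) (lin_sum _ _ _ (m1 _ _)).
  rewrite (lin_sum _ _ _ (r2 _ _)).
  rewrite -!big_split; apply: eq_bigr => k _ /=.
  rewrite !trunc_ext3_mono // !monoD; congr (_ + _ + _); congr mono; lia.
(* The outer coefficient of T_t is the innermost sum here; the exchanges bring
   it to the front, where it shares the index of the first bracket slot. *)
rewrite !trunc_map_mono (lin_sum _ _ _ (br1 _ _)) linear_sum /=.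
under [X in _ - X]eq_bigr => j _ do rewrite linear_sum /=.
under [X in _ - X]eq_bigr => j _ do
  under eq_bigr => k _ do rewrite trunc_map_mono.
under [X in _ - X]eq_bigr => j _ do rewrite exchange_big /=.
rewrite [X in _ - X]exchange_big /= -sumrB sum_ffunE; apply: eq_bigr => i _.
rewrite (lin_sum _ _ _ (br2 _ _)) -sumrB sum_ffunE; apply: eq_bigr => j _.
rewrite (lin_sum _ _ _ (br3 _ _)) -sumrB sum_ffunE [RHS]big_mkcond.
apply: eq_bigr => k _ /=; rewrite trunc_ext3_mono // !addn0 addnA -monoN -monoD.
by rewrite ffunE eq_sym; case: eqP.
Qed.

End TruncDefect.

(** * The obstruction class *)

Section Extension.

Variables (F : fieldType) (L V : lmodType F) (n : nat).
Variable Tt : 'I_n.+1 -> {linear V -> L}.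

Lemma extend_by_widen f (i : 'I_n.+1) :
  extend_by Tt f (widen_ord (leqnSn n.+1) i) = Tt i.
Proof.
have -> : widen_ord (leqnSn n.+1) i = lift ord_max i.
  by apply: val_inj; rewrite /= /bump leqNgt ltn_ord.
by rewrite /extend_by liftK.
Qed.

Lemma extend_by_max f : extend_by Tt f ord_max = f.
Proof. by rewrite /extend_by unlift_none. Qed.

Lemma extend_by_ord0 f : extend_by Tt f ord0 = Tt ord0.
Proof. by rewrite -(extend_by_widen f); congr extend_by; apply: val_inj. Qed.

Lemma trunc_map_extend f x :
  trunc_map (extend_by Tt f) x =
  trunc_map (extend_by Tt \0) x + mono n.+1 (f (x ord0)).
Proof.
move: x; apply: linear_mono_ext => [||k v].
- exact: trunc_map_linear.
- apply: linear_add; first exact: trunc_map_linear.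
  apply: (linear_comp _ (@mono_linear _ _ _ _)).
  exact: (linear_comp (@coef_linear _ _ _ _) (linearP f)).
rewrite !trunc_map_mono !(big_ord_recr n.+1) /= !extend_by_max.
rewrite (lin0 (mono_linear _ _)) addr0 mono_coef0; congr (_ + _).
  by apply: eq_bigr => i _; rewrite !extend_by_widen.
by rewrite mono_top; case: (k == 0%N); rewrite ?linear0.
Qed.

Variables (br : L -> L -> L -> L) (r m l : L -> L -> {linear V -> V}).
Hypotheses (hL : leibniz_triple_system br) (hV : lts_representation br r m l).
Variable T : {linear V -> L}.
Hypothesis hTt : deformation br r m l T Tt.

Let T0 f v : extend_by Tt f ord0 v = T v.
Proof. by rewrite extend_by_ord0; case: hTt. Qed.

Notation T_ f := (trunc_map (extend_by Tt f)).
Notation brt := (trunc_ext3 br (n := n.+1)).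
Notation rt := (trunc_End (n := n.+1) r).
Notation mt := (trunc_End (n := n.+1) m).
Notation lt := (trunc_End (n := n.+1) l).
Notation dt f := (trunc_defect br r m l (extend_by Tt f)).
Notation ob := (Ob br r m l Tt).

Let hbr := lts_trilinear hL.
Let hr := trilinear_End (rep_r_bilinear hV).
Let hm := trilinear_End (rep_m_bilinear hV).
Let hl := trilinear_End (rep_l_bilinear hV).
Let z0 := (trilinear0 hbr, trilinear0 hr, trilinear0 hm, trilinear0 hl).

(** Below degree n+1 the coefficients are those of the given deformation, hence
    0; in degree n+1 the added coefficient 0 contributes nothing and what is
    left is the sum defining Ob. *)
Lemma defect_extend0_const u v w :
  dt \0 (mono 0 u) (mono 0 v) (mono 0 w) = mono n.+1 (ob u v w).
Proof.
apply/ffunP=> s; rewrite trunc_defect_const // ffunE.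
set tm := defect_term _ _ _ _ _ u v w.
have tm1 j k : tm ord_max j k = 0.
  by rewrite /tm /defect_term !extend_by_max /= z0 subr0.
have tm2 i k : tm i ord_max k = 0.
  by rewrite /tm /defect_term !extend_by_max /= !z0 !addr0 linear0 subr0.
have tm3 i j : tm i j ord_max = 0.
  by rewrite /tm /defect_term !extend_by_max /= !z0 !addr0 linear0 subr0.
have -> : \sum_(i < n.+2) \sum_(j < n.+2) \sum_(k < n.+2 | (i + j + k == s)%N)
      tm i j k =
    \sum_(i < n.+1) \sum_(j < n.+1) \sum_(k < n.+1 | (i + j + k == s)%N)
      defect_term br r m l Tt u v w i j k.
  rewrite big_ord_recr /= [X in _ + X]big1 ?addr0; last first.
    by move=> j _; apply: big1.
  apply: eq_bigr => i _; rewrite big_ord_recr /= [X in _ + X]big1 ?addr0 //.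
  apply: eq_bigr => j _.
  rewrite big_mkcond big_ord_recr /= tm3 if_same addr0 -big_mkcond /=.
  by apply: eq_bigr => k _; rewrite /tm /defect_term !extend_by_widen.
have [sn|sn] := ltnP s n.+1.
  rewrite ltn_eqF // -[RHS]/(0 : L).
  have [_ /(_ u v w)/ffunP/(_ (Ordinal sn))] :=
    (deformation_defect br r m l T Tt).1 hTt.
  by rewrite trunc_defect_const // ffunE.
have -> : s = n.+1 :> nat by apply/eqP; rewrite eqn_leq sn -ltnS ltn_ord.
by rewrite eqxx.
Qed.

(** Ob is a coefficient of the defect, which is trilinear. *)
Lemma Ob_trilinear : trilinear ob.
Proof.
have obE u v w :
    ob u v w = dt \0 (mono 0 u) (mono 0 v) (mono 0 w) ord_max.
  by rewrite defect_extend0_const ffunE eqxx.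
have [h1 h2 h3] := trunc_defect_trilinear hL hV (extend_by Tt \0).
by split=> x y k a b; rewrite !obE mono_linear ?h1 ?h2 ?h3 !ffunE.
Qed.

(** The defect is t-linear, so the values t^{n+1} Ob on constants determine it;
    a factor t in any argument pushes them beyond the truncation order. *)
Lemma defect_extend0 x y z :
  dt \0 x y z = mono n.+1 (ob (x ord0) (y ord0) (z ord0)).
Proof.
have [o1 o2 o3] := Ob_trilinear; have oz := trilinear0 Ob_trilinear.
pose q (x' y' z' : trunc n.+1 V) : trunc n.+1 L :=
  mono n.+1 (ob (x' ord0) (y' ord0) (z' ord0)).
apply: (trilinear_mono_ext (trunc_defect_trilinear hL hV _) (q' := q)).
  by split=> x' y' k a b; rewrite /q !ffunE ?(o1, o2, o3) mono_linear.
move=> i j k a b c; rewrite /q !mono_coef0.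
have tE d (e : V) : mono d e = shift d (mono 0 e : trunc n.+1 V).
  by rewrite shift_mono.
rewrite (tE i) (tE j) (tE k) !(trunc_defect_shift hL hV) defect_extend0_const.
rewrite !shift_mono -!addnA mono_top !addn_eq0.
by case: (i == 0%N); case: (j == 0%N); case: (k == 0%N); rewrite ?oz.
Qed.

Let brtop := trunc_ext3_top n.+1 hbr.
Let rtop := trunc_ext3_top n.+1 hr.
Let mtop := trunc_ext3_top n.+1 hm.
Let ltop := trunc_ext3_top n.+1 hl.

(** On multiples of t^{n+1} the actions attached to the series reduce to those
    attached to its constant term T. *)
Lemma lT_top u v x :
  lT brt rt mt (T_ \0) u v (mono n.+1 x)
  = mono n.+1 (lT br r m T (u ord0) (v ord0) x).
Proof.
rewrite /lT /trunc_End /= /trunc_act brtop rtop mtop -monoD trunc_map_top.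
by rewrite !trunc_map_coef0 !T0 monoD monoN.
Qed.

Lemma mT_top u v x :
  mT brt rt lt (T_ \0) u v (mono n.+1 x)
  = mono n.+1 (mT br r l T (u ord0) (v ord0) x).
Proof.
rewrite /mT /trunc_End /= /trunc_act brtop rtop ltop -monoD trunc_map_top.
by rewrite !trunc_map_coef0 !T0 monoD monoN.
Qed.

Lemma rT_top u v x :
  rT brt mt lt (T_ \0) u v (mono n.+1 x)
  = mono n.+1 (rT br m l T (u ord0) (v ord0) x).
Proof.
rewrite /rT /trunc_End /= /trunc_act brtop mtop ltop -monoD trunc_map_top.
by rewrite !trunc_map_coef0 !T0 monoD monoN.
Qed.

Lemma brT_coef0 f x y z :
  brT rt mt lt (T_ f) x y z ord0 = brT r m l T (x ord0) (y ord0) (z ord0).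
Proof.
rewrite /brT /trunc_End /= /trunc_act 2!ffunE.
by rewrite !trunc_ext3_coef0 !trunc_map_coef0 !T0.
Qed.

(** The Bianchi identity of the continued series, evaluated at constants, is
    t^{n+1} times the cocycle condition. *)
Lemma Ob_cocycle : cocycle3 br r m l T ob.
Proof.
have topE := (defect_extend0, lT_top, mT_top, rT_top, brT_coef0).
have hLt := trunc_lts n.+1 hL; have hVt := trunc_rep n.+1 hL hV.
split=> [|v1 v2 v3 v4 v5|v1 v2 v3 v4 v5]; first exact: Ob_trilinear.
- apply: (@mono_top_inj F n.+1).
  have := d3_1_defect (T_ \0) hLt hVt (mono 0 v1) (mono 0 v2) (mono 0 v3)
    (mono 0 v4) (mono 0 v5).
  rewrite /d3_1 -/(trunc_defect _ _ _ _ _) !topE !mono_coef0 /=.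
  by rewrite -!(monoN, monoD).
- apply: (@mono_top_inj F n.+1).
  have := d3_2_defect (T_ \0) hLt hVt (mono 0 v1) (mono 0 v2) (mono 0 v3)
    (mono 0 v4) (mono 0 v5).
  rewrite /d3_2 -/(trunc_defect _ _ _ _ _) !topE !mono_coef0 /=.
  by rewrite -!(monoN, monoD).
Qed.

(** Terms with two factors t^{n+1} vanish, so f enters linearly. *)
Lemma brT_extend f u v w :
  brT rt mt lt (T_ f) (mono 0 u) (mono 0 v) (mono 0 w) =
  brT rt mt lt (T_ \0) (mono 0 u) (mono 0 v) (mono 0 w)
  + mono n.+1 (l (f u) (T v) w + l (T u) (f v) w
               + (m (f u) (T w) v + m (T u) (f w) v)
               + (r (f v) (T w) u + r (T v) (f w) u)).
Proof.
have rD := trilinearD (trunc_ext3_trilinear n.+1 hr).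
have mD := trilinearD (trunc_ext3_trilinear n.+1 hm).
have lD := trilinearD (trunc_ext3_trilinear n.+1 hl).
rewrite /brT /trunc_End /= /trunc_act !(trunc_map_extend f) !mono_coef0 /=.
rewrite !(rD, mD, lD) !(rtop, mtop, ltop) !trunc_map_coef0 !T0 !mono_coef0 /=.
rewrite !z0 !(lin0 (mono_linear _ _)) !monoD; zmodule.
Qed.

(** The part of the defect that is linear in f is the defining formula of d1. *)
Lemma defect_extend f u v w :
  dt f (mono 0 u) (mono 0 v) (mono 0 w) =
  mono n.+1 (ob u v w + d1 br r m l T f u v w).
Proof.
have brtD := trilinearD (trunc_ext3_trilinear n.+1 hbr).
have TD x y : T (x + y) = T x + T y by exact: linearD.
have T_D x y : T_ \0 (x + y) = T_ \0 x + T_ \0 y by exact: linearD.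
rewrite monoD -defect_extend0_const /trunc_defect /defect /=.
rewrite (trunc_map_extend f (brT _ _ _ _ _ _ _)) brT_coef0 brT_extend.
rewrite !(trunc_map_extend f (mono _ _)) !mono_coef0 /= T_D trunc_map_top.
rewrite !brtD !brtop !trunc_map_coef0 !T0 !mono_coef0 /= !z0.
rewrite !(lin0 (mono_linear _ _)) /d1 /rT /mT /lT !TD !(monoD, monoN).
zmodule.
Qed.

Lemma d1_opp f u v w :
  d1 br r m l T (fun x => - f x) u v w = - d1 br r m l T f u v w.
Proof.
have TN x : T (- x) = - T x by exact: linearN.
have TD x y : T (x + y) = T x + T y by exact: linearD.
have brN := trilinearN hbr; have rN := trilinearN hr.
have mN := trilinearN hm; have lN := trilinearN hl.
rewrite /d1 /rT /mT /lT !(brN, rN, mN, lN) !(TD, TN); zmodule.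
Qed.

Lemma extendable_iff :
  extendable br r m l T Tt <-> coboundary3 br r m l T ob.
Proof.
have extE f : deformation br r m l T (extend_by Tt f) <->
    forall u v w, ob u v w = - d1 br r m l T f u v w.
  split.
    move=> /deformation_defect[_ h] u v w; apply/eqP.
    rewrite -addr_eq0; apply/eqP/(@mono_top_inj F n.+1).
    by rewrite -defect_extend h.
  move=> h; apply/deformation_defect; split=> [v|u v w]; first exact: T0.
  by rewrite defect_extend h addNr (lin0 (mono_linear _ _)).
split=> [[f hf]|[f h]].
  by exists (\- f) => u v w; rewrite ((extE f).1 hf) -d1_opp.
exists (\- f); apply/(extE (\- f)) => u v w.
by rewrite h d1_opp opprK.
Qed.

End Extension.

Theorem theorem5p14 (F : fieldType) (L V : lmodType F)
    (br : L -> L -> L -> L) (r m l : L -> L -> {linear V -> V})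
    (T : {linear V -> L}) (n : nat) (Tt : 'I_n.+1 -> {linear V -> L})
    (hL : leibniz_triple_system br)
    (hV : lts_representation br r m l)
    (hT : relative_Rota_Baxter br r m l T)
    (hTt : deformation br r m l T Tt) :
  cocycle3 br r m l T (Ob br r m l Tt) /\
  (extendable br r m l T Tt <-> coboundary3 br r m l T (Ob br r m l Tt)).
Proof. by split; [exact: Ob_cocycle | exact: extendable_iff]. Qed.
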